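(* Let $\hat q=\tilde q_{\mathrm{st}}+\tilde q_{\mathcal I}\epsilon$ be a dual quaternion. (i) If $\tilde q_{\mathrm{st}}\neq \tilde 0$, then the normalization $$\hat u=\frac{\hat q}{|\hat q|}=\tilde u_{\mathrm{st}}+\tilde u_{\mathcal I}\epsilon,\qquad \tilde u_{\mathrm{st}}=\frac{\tilde q_{\mathrm{st}}}{|\tilde q_{\mathrm{st}}|},\qquad \tilde u_{\mathcal I}=\frac{\tilde q_{\mathcal I}}{|\tilde q_{\mathrm{st}}|}-\frac{\tilde q_{\mathrm{st}}}{|\tilde q_{\mathrm{st}}|}\,sc\!\left(\frac{\tilde q_{\mathrm{st}}^*}{|\tilde q_{\mathrm{st}}|}\frac{\tilde q_{\mathcal I}}{|\tilde q_{\mathrm{st}}|}\right)$$ is a unit dual quaternion and is a projection of $\hat q$ onto the set $\hat{\mathbb U}$ of unit dual quaternions, i.e. $$\hat u\in \mathop{\arg\min}_{\hat v\in\hat{\mathbb U}}\ |\hat v-\hat q|^2 .$$ (ii) If $\tilde q_{\mathrm{st}}=\tilde 0$ and $\tilde q_{\mathcal I}\neq\tilde 0$, then the projection of $\hat q$ onto $\hat{\mathbb U}$ (a minimizer of $|\hat v-\hat q|^2$ over $\hat v\in\hat{\mathbb U}$) is $\hat u=\tilde u_{\mathrm{st}}+\tilde u_{\mathcal I}\epsilon$, where $\tilde u_{\mathrm{st}}=\frac{\tilde q_{\mathcal I}}{|\tilde q_{\mathcal I}|}$ and $\tilde u_{\mathcal I}$ is any quaternion satisfying $sc(\tilde q_{\mathcal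 I}^*\tilde u_{\mathcal I})=0$.
   Context: Dual numbers: $a=a_{\mathrm{st}}+a_{\mathcal I}\epsilon$ with $a_{\mathrm{st}},a_{\mathcal I}\in\mathbb R$, $\epsilon\ne0$, $\epsilon^2=0$, with the usual addition and multiplication; $\epsilon$ commutes with quaternions. They are totally ordered by: $a>b$ iff $a_{\mathrm{st}}>b_{\mathrm{st}}$, or $a_{\mathrm{st}}=b_{\mathrm{st}}$ and $a_{\mathcal I}>b_{\mathcal I}$. Minimization of dual-number-valued functions is with respect to this order. Quaternions $\tilde q$ form $\mathbb Q$ (Hamilton's real quaternions), with conjugate $\tilde q^*$, magnitude $|\tilde q|$, and scalar part $sc(\tilde q)=\frac12(\tilde q+\tilde q^* )$, identified with a real number. A dual quaternion is $\hat q=\tilde q_{\mathrm{st}}+\tilde q_{\mathcal I}\epsilon$ with $\tilde q_{\mathrm{st}},\tilde q_{\mathcal I}\in\mathbb Q$, multiplied by $\hat p\hat q=\tilde p_{\mathrm{st}}\tilde q_{\mathrm{st}}+(\tilde p_{\mathrm{st}}\tilde q_{\mathcal I}+\tilde p_{\mathcal I}\tilde q_{\mathrm{st}})\epsilon$. Its magnitude is the dual number $|\hat q|=|\tilde q_{\mathrm{st}}|+\frac{sc(\tilde q_{\mathrm{st}}^*\tilde q_{\mathcal I})}{|\tilde q_{\mathrm{st}}|}\epsilon$ if $\tilde q_{\mathrm{st}}\ne\tilde 0$, and $|\hat q|=|\tilde q_{\mathcal I}|\epsilon$ otherwise. $\hat q$ is a unit dual quaternion ($\hat q\in\hat{\mathbb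 U}$) if $|\tilde q_{\mathrm{st}}|=1$ and $\tilde q_{\mathrm{st}}\tilde q_{\mathcal I}^*+\tilde q_{\mathcal I}\tilde q_{\mathrm{st}}^*=\tilde 0$. For a dual number $a$ with $a_{\mathrm{st}}\neq0$, division is $\frac{\hat q}{a}=\frac{\tilde q_{\mathrm{st}}}{a_{\mathrm{st}}}+\left(\frac{\tilde q_{\mathcal I}}{a_{\mathrm{st}}}-\frac{\tilde q_{\mathrm{st}}}{a_{\mathrm{st}}}\frac{a_{\mathcal I}}{a_{\mathrm{st}}}\right)\epsilon$. *)

(* Defs.v *)
From HB Require Import structures.
From mathcomp Require Import all_boot all_order all_algebra.
From mathcomp Require Import classical_sets reals.
From mathcomp Require Import ring.

Set Implicit Arguments.
Unset Strict Implicit.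
Unset Printing Implicit Defensive.

Import Order.TTheory GRing.Theory Num.Theory.

Local Open Scope ring_scope.
Local Open Scope classical_set_scope.

(** * Quaternions *)

(* [Quat a b c d] is a + b i + c j + d k. *)
Record quat (R : Type) : Type := Quat { qre : R; qi : R; qj : R; qk : R }.

Definition quat_to_prod (R : Type) (x : quat R) : R * R * R * R :=
  (qre x, qi x, qj x, qk x).
Definition quat_of_prod (R : Type) (x : R * R * R * R) : quat R :=
  Quat x.1.1.1 x.1.1.2 x.1.2 x.2.

Lemma quat_to_prodK (R : Type) : cancel (@quat_to_prod R) (@quat_of_prod R).
Proof. by case. Qed.

HB.instance Definition _ (R : choiceType) :=
  Choice.copy (quat R) (can_type (@quat_to_prodK R)).

Definition quat_zero (R : comNzRingType) : quat R := Quat 0 0 0 0.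
Definition quat_opp (R : comNzRingType) (x : quat R) : quat R :=
  Quat (- qre x) (- qi x) (- qj x) (- qk x).
Definition quat_add (R : comNzRingType) (x y : quat R) : quat R :=
  Quat (qre x + qre y) (qi x + qi y) (qj x + qj y) (qk x + qk y).
Definition quat_one (R : comNzRingType) : quat R := Quat 1 0 0 0.
Definition quat_mul (R : comNzRingType) (x y : quat R) : quat R :=
  Quat (qre x * qre y - qi x * qi y - qj x * qj y - qk x * qk y)
       (qre x * qi y + qi x * qre y + qj x * qk y - qk x * qj y)
       (qre x * qj y - qi x * qk y + qj x * qre y + qk x * qi y)
       (qre x * qk y + qi x * qj y - qj x * qi y + qk x * qre y).
Definition quat_scale (R : comNzRingType) (a : R) (x : quat R) : quat R :=
  Quat (a * qre x) (a * qi x) (a * qj x) (a * qk x).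

Fact quat_addA (R : comNzRingType) : associative (@quat_add R).
Proof. by move=> x y z; rewrite /quat_add /= !addrA. Qed.
Fact quat_addC (R : comNzRingType) : commutative (@quat_add R).
Proof. by move=> x y; congr Quat; rewrite addrC. Qed.
Fact quat_add0 (R : comNzRingType) : left_id (quat_zero R) (@quat_add R).
Proof. by case=> a b c d; rewrite /quat_add /= !add0r. Qed.
Fact quat_addN (R : comNzRingType) :
  left_inverse (quat_zero R) (@quat_opp R) (@quat_add R).
Proof. by move=> x; rewrite /quat_add /= !addNr. Qed.

HB.instance Definition _ (R : comNzRingType) :=
  GRing.isZmodule.Build (quat R) (@quat_addA R) (@quat_addC R)
    (@quat_add0 R) (@quat_addN R).

Fact quat_mulA (R : comNzRingType) : associative (@quat_mul R).
Proof. by move=> x y z; congr Quat => /=; ring. Qed.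
Fact quat_mul1l (R : comNzRingType) : left_id (quat_one R) (@quat_mul R).
Proof. by case=> a b c d; congr Quat => /=; ring. Qed.
Fact quat_mul1r (R : comNzRingType) : right_id (quat_one R) (@quat_mul R).
Proof. by case=> a b c d; congr Quat => /=; ring. Qed.
Fact quat_mulDl (R : comNzRingType) : left_distributive (@quat_mul R) +%R.
Proof. by move=> x y z; congr Quat => /=; ring. Qed.
Fact quat_mulDr (R : comNzRingType) : right_distributive (@quat_mul R) +%R.
Proof. by move=> x y z; congr Quat => /=; ring. Qed.
Fact quat_one_neq0 (R : comNzRingType) : quat_one R != 0.
Proof. by apply/eqP => -[] /eqP; rewrite oner_eq0. Qed.

HB.instance Definition _ (R : comNzRingType) :=
  GRing.Zmodule_isNzRing.Build (quat R) (@quat_mulA R) (@quat_mul1l R)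
    (@quat_mul1r R) (@quat_mulDl R) (@quat_mulDr R) (@quat_one_neq0 R).

Fact quat_scaleA (R : comNzRingType) (a b : R) (x : quat R) :
  quat_scale a (quat_scale b x) = quat_scale (a * b) x.
Proof. by congr Quat => /=; rewrite mulrA. Qed.
Fact quat_scale1 (R : comNzRingType) : left_id 1 (@quat_scale R).
Proof. by case=> a b c d; congr Quat; rewrite mul1r. Qed.
Fact quat_scaleDr (R : comNzRingType) :
  right_distributive (@quat_scale R) +%R.
Proof. by move=> a x y; congr Quat; rewrite mulrDr. Qed.
Fact quat_scaleDl (R : comNzRingType) (x : quat R) :
  {morph (@quat_scale R)^~ x : a b / a + b}.
Proof. by move=> a b; congr Quat; rewrite mulrDl. Qed.

HB.instance Definition _ (R : comNzRingType) :=
  GRing.Zmodule_isLmodule.Build R (quat R) (@quat_scaleA R) (@quat_scale1 R)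
    (@quat_scaleDr R) (@quat_scaleDl R).

Fact quat_scaleAl (R : comNzRingType) (a : R) (x y : quat R) :
  a *: (x * y) = (a *: x) * y.
Proof. by congr Quat => /=; ring. Qed.
HB.instance Definition _ (R : comNzRingType) :=
  GRing.Lmodule_isLalgebra.Build R (quat R) (@quat_scaleAl R).

Fact quat_scaleAr (R : comNzRingType) (a : R) (x y : quat R) :
  a *: (x * y) = x * (a *: y).
Proof. by congr Quat => /=; ring. Qed.
HB.instance Definition _ (R : comNzRingType) :=
  GRing.Lalgebra_isAlgebra.Build R (quat R) (@quat_scaleAr R).

Definition qconj (R : comNzRingType) (x : quat R) : quat R :=
  Quat (qre x) (- qi x) (- qj x) (- qk x).

Definition qnorm (R : rcfType) (x : quat R) : R :=
  Num.sqrt (qre x ^+ 2 + qi x ^+ 2 + qj x ^+ 2 + qk x ^+ 2).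

(* The scalar part, as an element of the base ring; [sc_half_sum] is its usual
   definition (x + x^* ) / 2, with R embedded in [quat R] by [a |-> a%:A]. *)
Definition sc (R : comNzRingType) (x : quat R) : R := qre x.

Lemma sc_half_sum (R : numFieldType) (x : quat R) :
  (sc x)%:A = 2^-1 *: (x + qconj x).
Proof.
case: x => a b c d; rewrite /sc /=; congr Quat; rewrite /= ?subrr ?mulr0 //.
by field.
Qed.

(** * Dual numbers and dual quaternions *)

(* [Dual a b] is a + b epsilon, with epsilon^2 = 0 and epsilon central.
   Dual numbers are [dual R] and dual quaternions are [dual (quat R)]. *)
Record dual (A : Type) : Type := Dual { dst : A; dinf : A }.

Definition dual_to_prod (A : Type) (x : dual A) : A * A := (dst x, dinf x).
Definition dual_of_prod (A : Type) (x : A * A) : dual A := Dual x.1 x.2.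

Lemma dual_to_prodK (A : Type) : cancel (@dual_to_prod A) (@dual_of_prod A).
Proof. by case. Qed.

HB.instance Definition _ (A : choiceType) :=
  Choice.copy (dual A) (can_type (@dual_to_prodK A)).

Definition dual_zero (A : nzRingType) : dual A := Dual 0 0.
Definition dual_opp (A : nzRingType) (x : dual A) : dual A :=
  Dual (- dst x) (- dinf x).
Definition dual_add (A : nzRingType) (x y : dual A) : dual A :=
  Dual (dst x + dst y) (dinf x + dinf y).
Definition dual_one (A : nzRingType) : dual A := Dual 1 0.
Definition dual_mul (A : nzRingType) (x y : dual A) : dual A :=
  Dual (dst x * dst y) (dst x * dinf y + dinf x * dst y).

Fact dual_addA (A : nzRingType) : associative (@dual_add A).
Proof. by move=> x y z; rewrite /dual_add /= !addrA. Qed.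
Fact dual_addC (A : nzRingType) : commutative (@dual_add A).
Proof. by move=> x y; congr Dual; rewrite addrC. Qed.
Fact dual_add0 (A : nzRingType) : left_id (dual_zero A) (@dual_add A).
Proof. by case=> a b; rewrite /dual_add /= !add0r. Qed.
Fact dual_addN (A : nzRingType) :
  left_inverse (dual_zero A) (@dual_opp A) (@dual_add A).
Proof. by move=> x; rewrite /dual_add /= !addNr. Qed.

HB.instance Definition _ (A : nzRingType) :=
  GRing.isZmodule.Build (dual A) (@dual_addA A) (@dual_addC A)
    (@dual_add0 A) (@dual_addN A).

Fact dual_mulA (A : nzRingType) : associative (@dual_mul A).
Proof.
by move=> x y z; congr Dual; rewrite /= ?mulrA // mulrDr mulrDl !mulrA addrA.
Qed.
Fact dual_mul1l (A : nzRingType) : left_id (dual_one A) (@dual_mul A).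
Proof. by case=> a b; congr Dual; rewrite /= ?mul0r ?addr0 mul1r. Qed.
Fact dual_mul1r (A : nzRingType) : right_id (dual_one A) (@dual_mul A).
Proof. by case=> a b; congr Dual; rewrite /= ?mulr0 ?add0r mulr1. Qed.
Fact dual_mulDl (A : nzRingType) : left_distributive (@dual_mul A) +%R.
Proof. by move=> x y z; congr Dual; rewrite /= !mulrDl // addrACA. Qed.
Fact dual_mulDr (A : nzRingType) : right_distributive (@dual_mul A) +%R.
Proof. by move=> x y z; congr Dual; rewrite /= !mulrDr // addrACA. Qed.
Fact dual_one_neq0 (A : nzRingType) : dual_one A != 0.
Proof. by apply/eqP => -[] /eqP; rewrite oner_eq0. Qed.

HB.instance Definition _ (A : nzRingType) :=
  GRing.Zmodule_isNzRing.Build (dual A) (@dual_mulA A) (@dual_mul1l A)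
    (@dual_mul1r A) (@dual_mulDl A) (@dual_mulDr A) (@dual_one_neq0 A).

Definition dual_lt (R : realDomainType) (x y : dual R) : bool :=
  (dst x < dst y) || (dst x == dst y) && (dinf x < dinf y).

Fact dual_lt_irr (R : realDomainType) : irreflexive (@dual_lt R).
Proof. by move=> x; rewrite /dual_lt !ltxx andbF. Qed.
Fact dual_lt_trans (R : realDomainType) : transitive (@dual_lt R).
Proof.
move=> y x z; rewrite /dual_lt.
move=> /orP[xy|/andP[/eqP-> xy]] /orP[yz|/andP[/eqP<- yz]].
- by rewrite (lt_trans xy yz).
- by rewrite xy.
- by rewrite yz.
- by rewrite eqxx (lt_trans xy yz) orbT.
Qed.

HB.instance Definition _ (R : realDomainType) :=
  Order.Lt_isPOrder.Build ring_display (dual R)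
    (@dual_lt_irr R) (@dual_lt_trans R).

Fact dual_le_total (R : realDomainType) : total (<=%R : rel (dual R)).
Proof.
move=> [a b] [c d]; rewrite !le_eqVlt /Order.lt /= /dual_lt /=.
by case: (ltgtP a c) => [_|_|->] /=; rewrite ?orbT //;
  case: (ltgtP b d) => [_|_|->] /=; rewrite ?orbT ?eqxx.
Qed.

HB.instance Definition _ (R : realDomainType) :=
  Order.POrder_isTotal.Build ring_display (dual R) (@dual_le_total R).

Definition dqnorm (R : rcfType) (q : dual (quat R)) : dual R :=
  if dst q == 0 then Dual 0 (qnorm (dinf q))
  else Dual (qnorm (dst q)) (sc (qconj (dst q) * dinf q) / qnorm (dst q)).

(* Only meaningful when [dst a != 0]. *)
Definition dqdiv (R : fieldType) (q : dual (quat R)) (a : dual R) :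
    dual (quat R) :=
  Dual ((dst a)^-1 *: dst q)
       ((dst a)^-1 *: dinf q - (dinf a / dst a) *: ((dst a)^-1 *: dst q)).

Definition unit_dq (R : rcfType) : set (dual (quat R)) :=
  [set q | qnorm (dst q) = 1 /\
           dst q * qconj (dinf q) + dinf q * qconj (dst q) = 0].
Arguments unit_dq {R}.

Definition argmin (d : Order.disp_t) (V : porderType d) (T : Type)
    (D : set T) (f : T -> V) : set T :=
  [set x | D x /\ forall y, D y -> (f x <= f y)%O].

(* Main.v *)
Require Import Defs.
From mathcomp Require Import all_boot all_order all_algebra.
From mathcomp Require Import classical_sets reals.
From mathcomp Require Import ring lra.

Import Order.TTheory GRing.Theory Num.Theory.

Local Open Scope ring_scope.
Local Open Scope classical_set_scope.

(** Write <x, y> = sc (x^* y) for the Euclidean inner product of quaternions,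
    seen as vectors of R^4.  Three facts turn the statement into Euclidean
    geometry.  A dual quaternion v is unit iff v_st lies on the unit sphere and
    v_I is tangent to it at v_st: <v_st, v_I> = 0 ([unit_dqP]).  The squared
    magnitude of w is the dual number |w_st|^2 + 2 <w_st, w_I> epsilon, with no
    case distinction on w_st ([dqnorm_sqr]).  And the order on dual numbers is
    lexicographic ([dual_leP]).  Minimising |v - q|^2 over the unit dual
    quaternions thus means minimising |v_st - q_st|^2 over the sphere, and then
    <v_st - q_st, v_I - q_I> among the ties.

    If q_st = n u with |u| = 1 and n > 0, the first criterion exceeds its value
    at u by n |v_st - u|^2, so v_st = u is its only minimiser; and at v_st = u
    tangency of v_I reduces the second criterion to -(1 - n) <u, q_I>, which
    does not depend on v_I.  Hence every unit v with standard part u is a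
    minimiser, in particular the normalisation of q.

    If q_st = 0, the first criterion is constantly 1, and the second one is
    -<v_st, q_I> by tangency.  With q_I = m u, |u| = 1 and m > 0, this exceeds
    its value at u by (m / 2) |v_st - u|^2: the minimisers are exactly the unit
    v with standard part u.

    Both excesses come from the single identity
    <v, n u> = n - (n / 2) |v - u|^2 for unit vectors u and v ([qdot_sphere]),
    a form of Cauchy-Schwarz that includes the case of equality. *)

(** * The Euclidean inner product of quaternions *)

Definition qdot {R : comNzRingType} (x y : quat R) : R := sc (qconj x * y).

Lemma qdotE (R : comNzRingType) (x y : quat R) :
  qdot x y = qre x * qre y + qi x * qi y + qj x * qj y + qk x * qk y.
Proof.
have -> : qdot x y = qre x * qre y - (- qi x) * qi y - (- qj x) * qj y
                     - (- qk x) * qk y by [].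
by ring.
Qed.

Lemma qdotC (R : comNzRingType) (x y : quat R) : qdot x y = qdot y x.
Proof. by rewrite !qdotE; ring. Qed.

Lemma qdotBl (R : comNzRingType) (x y z : quat R) :
  qdot (x - y) z = qdot x z - qdot y z.
Proof. by rewrite !qdotE /=; ring. Qed.

Lemma qdotZl (R : comNzRingType) (a : R) (x y : quat R) :
  qdot (a *: x) y = a * qdot x y.
Proof. by rewrite !qdotE /=; ring. Qed.

Lemma qdotBr (R : comNzRingType) (x y z : quat R) :
  qdot x (y - z) = qdot x y - qdot x z.
Proof. by rewrite !(qdotC _ x) qdotBl. Qed.

Lemma qdotZr (R : comNzRingType) (a : R) (x y : quat R) :
  qdot x (a *: y) = a * qdot x y.
Proof. by rewrite !(qdotC _ x) qdotZl. Qed.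

Lemma qdot_ge0 (R : realDomainType) (x : quat R) : 0 <= qdot x x.
Proof. by rewrite qdotE -!expr2 !addr_ge0 ?sqr_ge0. Qed.

Lemma qdot_eq0 (R : realDomainType) (x : quat R) : qdot x x = 0 -> x = 0.
Proof.
rewrite qdotE -!expr2; case: x => a b c d /= /eqP.
rewrite !paddr_eq0 ?addr_ge0 ?sqr_ge0 // !sqrf_eq0.
by case/andP=> /andP[/andP[/eqP-> /eqP->] /eqP->] /eqP->.
Qed.

Lemma qnorm_sqr (R : rcfType) (x : quat R) : qnorm x ^+ 2 = qdot x x.
Proof.
by rewrite /qnorm sqr_sqrtr ?addr_ge0 ?sqr_ge0 // qdotE !expr2.
Qed.

Lemma qnorm_gt0 (R : rcfType) (x : quat R) : x <> 0 -> 0 < qnorm x.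
Proof.
move=> x0; rewrite lt_def sqrtr_ge0 andbT; apply/eqP => n0.
by apply: x0; apply: qdot_eq0; rewrite -qnorm_sqr n0 expr0n.
Qed.

Lemma qnorm_eq1 (R : rcfType) (x : quat R) : qnorm x = 1 <-> qdot x x = 1.
Proof.
rewrite -qnorm_sqr; split=> [->|/eqP]; first by rewrite expr1n.
by rewrite sqrp_eq1 ?sqrtr_ge0 // => /eqP.
Qed.

Lemma qdot_normalize (R : rcfType) (x : quat R) :
  x <> 0 -> qdot ((qnorm x)^-1 *: x) ((qnorm x)^-1 *: x) = 1.
Proof.
move=> /qnorm_gt0 n0; rewrite qdotZl qdotZr -qnorm_sqr.
by field; rewrite gt_eqF.
Qed.

(** Expanding |v - u|^2 = 2 - 2 <v, u>.  The defect is kept as a square, so that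
    its vanishing identifies the unique point of the sphere maximising <., n u>
    when n > 0. *)
Lemma qdot_sphere (R : realFieldType) (n : R) (u v : quat R) :
  qdot u u = 1 -> qdot v v = 1 ->
  qdot v (n *: u) = n - n / 2 * qdot (v - u) (v - u).
Proof.
move=> u1 v1; rewrite qdotZr qdotBl !qdotBr u1 v1 (qdotC _ u v).
by field.
Qed.

(** * Dual numbers and unit dual quaternions *)

Lemma dual_leP (R : realDomainType) (x y : dual R) :
  reflect (dst x < dst y \/ dst x = dst y /\ dinf x <= dinf y) (x <= y).
Proof.
have -> : (x <= y) = (dst x < dst y) || (dst x == dst y) && (dinf x <= dinf y).
  case: x y => [a b] [c d].
  rewrite [LHS]le_eqVlt [in LHS]/Order.lt /= /dual_lt /=.
  have -> : (Dual a b == Dual c d) = (a == c) && (b == d).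
    by apply/eqP/andP => [[-> ->]|[/eqP-> /eqP->]].
  by rewrite (le_eqVlt b) orbCA andb_orr.
apply: (iffP orP) => [[lt_xy|/andP[/eqP eq_xy le_xy]]|[lt_xy|[eq_xy le_xy]]].
- by left.
- by right.
- by left.
- by right; rewrite eq_xy eqxx.
Qed.

(** The excluded case w_st = 0 of the generic formula for the magnitude causes
    no exception here: there |w| is a multiple of epsilon, which squares to 0. *)
Lemma dqnorm_sqr (R : rcfType) (w : dual (quat R)) :
  dqnorm w ^+ 2 = Dual (qdot (dst w) (dst w)) (2 * qdot (dst w) (dinf w)).
Proof.
have sqrE (a b : R) : Dual a b ^+ 2 = Dual (a * a) (a * b + b * a) by [].
rewrite /dqnorm; case: eqP => [w0|/qnorm_gt0 n0]; rewrite sqrE.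
  by congr Dual; rewrite w0 qdotE /=; ring.
congr Dual; first by rewrite -expr2 qnorm_sqr.
by rewrite -/(qdot _ _); field; rewrite gt_eqF.
Qed.

Lemma unit_dqP (R : rcfType) (v : dual (quat R)) :
  unit_dq v <-> qdot (dst v) (dst v) = 1 /\ qdot (dst v) (dinf v) = 0.
Proof.
rewrite /unit_dq /= qnorm_eq1.
(* x y^* + y x^* is self-conjugate, so it is its scalar part, 2 <x, y>. *)
have -> : dst v * qconj (dinf v) + dinf v * qconj (dst v) =
          (2 * qdot (dst v) (dinf v))%:A.
  by case: v => [[a b c d] [e f g h]]; rewrite qdotE; congr Quat => /=; ring.
split=> -[v1 v0]; split=> //; last by rewrite v0 mulr0 scale0r.
move/(congr1 (@qre R)): v0; rewrite /= mulr1 => /eqP.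
by rewrite mulf_eq0 pnatr_eq0 => /eqP.
Qed.

(** * Minimisers of the distance to a dual quaternion *)

(** The infinitesimal part of u is constrained by tangency alone: once v_st is
    the nearest point of the sphere, v_st - q_st is normal to the sphere there,
    so moving v_I along the tangent space leaves the distance unchanged. *)
Lemma argmin_st_neq0 (R : rcfType) (q u : dual (quat R)) :
  dst q <> 0 -> unit_dq u -> dst u = (qnorm (dst q))^-1 *: dst q ->
  argmin unit_dq (fun v => dqnorm (v - q) ^+ 2) u.
Proof.
move=> /qnorm_gt0; set n := qnorm (dst q) => n0 uU uE.
have qE : dst q = n *: dst u by rewrite uE scalerA divff ?scale1r ?gt_eqF.
split=> // v /unit_dqP[v1 v0]; move/unit_dqP: (uU) => [u1 u0].
rewrite !dqnorm_sqr; apply/dual_leP => /=; rewrite qE.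
have excess : qdot (dst v - n *: dst u) (dst v - n *: dst u) =
    qdot (dst u - n *: dst u) (dst u - n *: dst u)
    + n * qdot (dst v - dst u) (dst v - dst u).
  rewrite ![qdot (_ - n *: _) _]qdotBl ![qdot _ (_ - n *: _)]qdotBr.
  rewrite !(qdotC _ (n *: _) (dst v)) (qdot_sphere _ n _ _ u1 v1) v1.
  by rewrite !qdotZl !qdotZr u1; field.
rewrite excess; have := qdot_ge0 _ (dst v - dst u).
rewrite le_eqVlt => /orP[/eqP D0|D0]; last first.
  by left; rewrite ltrDl mulr_gt0.
have /eqP := qdot_eq0 _ _ (esym D0); rewrite subr_eq0 => /eqP vE.
right; split; first by rewrite -D0 mulr0 addr0.
rewrite vE !qdotBl !qdotBr !qdotZl u0 -vE v0 vE.
exact: lexx.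
Qed.

Lemma dqnorm_sqrB_st0 (R : rcfType) (q v : dual (quat R)) :
  dst q = 0 -> unit_dq v ->
  dqnorm (v - q) ^+ 2 = Dual 1 (- (2 * qdot (dst v) (dinf q))).
Proof.
move=> q0 /unit_dqP[v1 v0]; rewrite dqnorm_sqr /= q0 subr0 v1 qdotBr v0.
by congr Dual; ring.
Qed.

(** All points of the sphere are equally far from 0, so the infinitesimal part
    of the distance decides.  The minimum is unique in v_st because the competitor
    with standard part c = q_I / |q_I| and zero infinitesimal part is unit. *)
Lemma argmin_st_eq0 (R : rcfType) (q u : dual (quat R)) :
  dst q = 0 -> dinf q <> 0 ->
  argmin unit_dq (fun v => dqnorm (v - q) ^+ 2) u <->
  unit_dq u /\ dst u = (qnorm (dinf q))^-1 *: dinf q.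
Proof.
move=> q0 qI0; have c1 := qdot_normalize _ _ qI0.
have m0 := qnorm_gt0 _ _ qI0.
set m := qnorm (dinf q) in c1 m0 *; set c := m^-1 *: dinf q in c1 *.
have qE : dinf q = m *: c by rewrite /c scalerA divff ?scale1r ?gt_eqF.
have dotE v : unit_dq v ->
    qdot (dst v) (dinf q) = m - m / 2 * qdot (dst v - c) (dst v - c).
  by move=> /unit_dqP[v1 _]; rewrite qE qdot_sphere.
have cc0 : qdot (c - c) (c - c) = 0 by rewrite qdotBl subrr.
split=> [[uU umin]|[uU uE]].
  split=> //; have cU : unit_dq (Dual c 0).
    by apply/unit_dqP; split=> //=; rewrite -(scale0r 0) qdotZr mul0r.
  have := umin _ cU; rewrite !dqnorm_sqrB_st0 // !dotE //= cc0.
  case/dual_leP=> /= [|[_ le_uc]]; first by rewrite ltxx.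
  have D0 : qdot (dst u - c) (dst u - c) <= 0.
    by rewrite -(pmulr_rle0 _ m0); lra.
  have /eqP := qdot_eq0 _ _ (le_anti (introT andP (conj D0 (qdot_ge0 _ _)))).
  by rewrite subr_eq0 => /eqP.
split=> // v vU; rewrite !dqnorm_sqrB_st0 // !dotE // uE cc0.
apply/dual_leP; right; split=> //=.
have := mulr_ge0 (ltW m0) (qdot_ge0 _ (dst v - c)); lra.
Qed.

Theorem theorem3p1 (R : realType) (q : dual (quat R)) :
  (dst q <> 0 ->
   let n := qnorm (dst q) in
   let u := dqdiv q (dqnorm q) in
   [/\ dst u = n^-1 *: dst q,
       dinf u = n^-1 *: dinf q -
         sc ((n^-1 *: qconj (dst q)) * (n^-1 *: dinf q)) *: (n^-1 *: dst q),
       unit_dq u &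
       argmin unit_dq (fun v => dqnorm (v - q) ^+ 2) u])
  /\
  (dst q = 0 -> dinf q <> 0 ->
   forall u : dual (quat R),
     argmin unit_dq (fun v => dqnorm (v - q) ^+ 2) u <->
     dst u = (qnorm (dinf q))^-1 *: dinf q /\
     sc (qconj (dinf q) * dinf u) = 0).
Proof.
split=> [q0 n u|q0 qI0 u].
  have n0 : n != 0 by rewrite gt_eqF ?qnorm_gt0.
  have normE : dqnorm q = Dual n (qdot (dst q) (dinf q) / n).
    by rewrite /dqnorm; case: eqP.
  have uE : dst u = n^-1 *: dst q by rewrite /u normE.
  have uIE : dinf u = n^-1 *: dinf q -
      sc ((n^-1 *: qconj (dst q)) * (n^-1 *: dinf q)) *: (n^-1 *: dst q).
    have -> : sc ((n^-1 *: qconj (dst q)) * (n^-1 *: dinf q)) =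
              n^-1 * (n^-1 * qdot (dst q) (dinf q)).
      by rewrite -scalerAl -scalerAr.
    rewrite /u normE /dqdiv [dst (Dual _ _)]/= [dinf (Dual _ _)]/=.
    by congr (_ - _ *: _); field.
  have uU : unit_dq u.
    apply/unit_dqP; split; first by rewrite uE qdot_normalize.
    (* The scalar subtracted in u_I is <u_st, q_I / n>: u_I is the component of
       q_I / n orthogonal to the unit vector u_st. *)
    have -> : dinf u = n^-1 *: dinf q - qdot (dst u) (n^-1 *: dinf q) *: dst u.
      by rewrite uIE uE /qdot; congr (_ - sc (_ * _) *: _);
        congr Quat; rewrite /= mulrN.
    by rewrite qdotBr [qdot _ (qdot _ _ *: _)]qdotZr uE qdot_normalize // mulr1
      subrr.
  by split=> //; apply: argmin_st_neq0.
rewrite argmin_st_eq0 // unit_dqP -/(qdot (dinf q) (dinf u)).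
have n0 : (qnorm (dinf q))^-1 != 0 by rewrite invr_eq0 gt_eqF ?qnorm_gt0.
split=> [[[_ u0] uE]|[uE u0]]; split=> //.
  by move: u0; rewrite uE qdotZl => /eqP; rewrite mulf_eq0 (negPf n0) => /eqP.
by split; rewrite uE; [exact: qdot_normalize|rewrite qdotZl u0 mulr0].
Qed.
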